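(* Let $\mathcal{S}$ be a (multiplicative) semigroup of nonnegative $n\times n$ matrices. Suppose that for every matrix $S\in\mathcal{S}$ there exists a permutation matrix $P_S$ (depending on $S$) such that the matrix $P_S S P_S^{-1}$ is upper triangular. If $\mathcal{D}(ST)=\mathcal{D}(TS)$ for every pair $S,T\in\mathcal{S}$, then there exists a permutation matrix $P$ such that every matrix in the semigroup $P\mathcal{S}P^{-1}$ is upper triangular.
   Context: A nonnegative matrix is a real matrix with all entries $\ge 0$. A semigroup of matrices is a set of matrices closed under matrix multiplication. For an $n\times n$ matrix $T$, $\mathcal{D}(T)$ denotes its diagonal, i.e. the diagonal matrix having the same diagonal entries as $T$. $P\mathcal{S}P^{-1}=\{PSP^{-1}: S\in\mathcal{S}\}$. *)

(* Defs.v *)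
From HB Require Import structures.
From mathcomp Require Import all_boot all_order all_algebra.
From mathcomp Require Import classical_sets reals.

Set Implicit Arguments.
Unset Strict Implicit.
Unset Printing Implicit Defensive.

Import Order.TTheory GRing.Theory Num.Theory.
Local Open Scope classical_set_scope.
Local Open Scope ring_scope.

(* The library's is_trig_mx means LOWER triangular. *)
Definition upper_triangular (R : realType) (n : nat) (A : 'M[R]_n) : bool :=
  is_trig_mx A^T.

Lemma upper_triangularP (R : realType) (n : nat) (A : 'M[R]_n) :
  reflect (forall i j : 'I_n, (j < i)%N -> A i j = 0) (upper_triangular A).
Proof.
apply: (iffP idP) => [/is_trig_mxP H i j ltji|H].
  by have := H j i ltji; rewrite mxE.
by apply/is_trig_mxP => i j ltij; rewrite mxE H.
Qed.

Definition nonneg_mx (R : realType) (n : nat) (A : 'M[R]_n) : Prop :=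
  forall i j : 'I_n, 0 <= A i j.

Definition mx_semigroup (R : realType) (n : nat) (S : set 'M[R]_n) : Prop :=
  forall A B : 'M[R]_n, S A -> S B -> S (A *m B).

Definition diag_part (R : realType) (n : nat) (T : 'M[R]_n) : 'M[R]_n :=
  diag_mx (\row_(i < n) T i i).

(* Main.v *)
Require Import Defs.
From HB Require Import structures.
From mathcomp Require Import all_boot all_order all_fingroup all_algebra.
From mathcomp Require Import boolp classical_sets reals.

(** Write [x -> y] when some matrix of the semigroup has a positive [(x, y)]
    entry.  Products of nonnegative matrices never cancel, so this relation is
    transitive, and a permutation triangularizes the whole semigroup as soon as
    the relation is antisymmetric ([linear_extension], [upper_triangular_perm]).

    Antisymmetry is where the diagonals come in ([crossing_entries_eq]).  Suppose
    [A i j > 0] and [B j i > 0].  Let [L] be the set of [x] where the common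
    diagonal of [A B] and [B A] is positive.  For each [x] in [L], positivity of
    [(A B) x x] provides a [k] with [A x k > 0] and [B k x > 0]; then
    [(B A) k k > 0], so [k] is again in [L].  Choosing such a [k] for each [x]
    gives a map [phi : L -> L], which may be taken to send [i] to [j].  If
    [phi x = phi y], then [(A B) x y] and [(A B) y x] are both positive, whence
    [x = y] because [A B] is itself triangularizable: [phi] is injective, so it
    permutes [L].  But all the entries [A x (phi x)] are positive, and in a
    triangularizing order for [A] this says that [phi] never moves a point
    down.  A permutation of a finite set with that property is the identity
    ([inflationary_perm_id]), so [i = j]. *)

Set Implicit Arguments.
Unset Strict Implicit.
Unset Printing Implicit Defensive.

Import Order.TTheory GRing.Theory Num.Theory.
Local Open Scope ring_scope.

(** Rank [x] by its number of strict predecessors, break ties by the index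
    [x] itself, and number the elements in the order of the resulting keys. *)
Lemma linear_extension (n : nat) (r : rel 'I_n) :
  transitive r -> antisymmetric r ->
  exists s : 'S_n, forall x y, r x y -> (s x <= s y)%N.
Proof.
move=> r_trans r_anti.
pose d x := #|[set k | r k x & k != x]|.
have d_lt x y : r x y -> x != y -> (d x < d y)%N.
  move=> rxy nxy; apply/proper_card/properP; split; last first.
    by exists x; rewrite inE ?rxy ?nxy // eqxx andbF.
  apply/fintype.subsetP => k; rewrite !inE => /andP[rkx nkx].
  rewrite (r_trans _ _ _ rkx rxy); apply: contraNneq nkx => eky.
  by apply/eqP/r_anti; rewrite rkx eky rxy.
pose key (x : 'I_n) := (d x * n + x)%N.
have key_lt x y : (d x < d y)%N -> (key x < key y)%N.
  move=> dxy; apply: (@leq_trans (d x * n + n)%N); first by rewrite ltn_add2l.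
  by rewrite -mulSnr; apply: leq_trans (leq_addr _ _); rewrite leq_mul2r dxy orbT.
have key_inj : injective key.
  move=> x y exy; apply: val_inj => /=.
  have edxy : d x = d y.
    by apply/eqP; case: ltngtP => // /key_lt; rewrite exy ltnn.
  by apply/eqP; rewrite -(eqn_add2l (d x * n)) {2}edxy -/(key x) exy.
pose rk x := #|[set k | (key k < key x)%N]|.
have rk_lt x y : (key x < key y)%N -> (rk x < rk y)%N.
  move=> kxy; apply/proper_card/properP; split; last first.
    by exists x; rewrite inE ?ltnn.
  by apply/fintype.subsetP => k; rewrite !inE => /ltn_trans; apply.
have rk_bound x : (rk x < n)%N.
  rewrite -[X in (_ < X)%N]card_ord -cardsT; apply/proper_card/properP.
  by split; [exact: finset.subsetT | exists x; rewrite inE ?ltnn].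
pose f x := Ordinal (rk_bound x).
have f_inj : injective f.
  move=> x y /(congr1 val) /= exy; apply: key_inj; apply/eqP.
  by case: ltngtP => // /rk_lt; rewrite exy ltnn.
exists (perm f_inj) => x y rxy; rewrite !permE /=.
have [-> //|nxy] := eqVneq x y.
exact/ltnW/rk_lt/key_lt/d_lt.
Qed.

(** The values of the rank [h] over [L] and over [phi @: L = L] have the same
    sum, so the termwise inequalities are all equalities. *)
Lemma inflationary_perm_id (T : finType) (L : {set T}) (phi : T -> T)
    (h : T -> nat) :
  injective h -> {in L &, injective phi} -> {in L, forall x, phi x \in L} ->
  {in L, forall x, h x <= h (phi x)}%N ->
  {in L, forall x, phi x = x}.
Proof.
move=> h_inj phi_inj phi_L h_le x Lx.
have im_phi : phi @: L = L.
  apply/eqP; rewrite eqEcard card_in_imset // leqnn andbT.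
  by apply/fintype.subsetP => _ /imsetP[y Ly ->]; apply: phi_L.
have sum_eq : (\sum_(y in L) h (phi y) = \sum_(y in L) h y)%N.
  by rewrite -[in RHS]im_phi big_imset.
have leif_h y : y \in L -> (h y <= h (phi y) ?= iff (h y == h (phi y)))%N.
  by move=> Ly; split; first exact: h_le.
have [_] := leqif_sum leif_h; rewrite sum_eq eqxx => /esym/forall_inP.
by move=> /(_ x Lx)/eqP/h_inj/esym.
Qed.

Section NonnegativeMatrices.
Variables (R : realType) (n : nat).
Implicit Types A B : 'M[R]_n.

(** Conjugating by the inverse of [s] moves [x] to position [s x], so [s] itself
    is the order along which the nonzero entries go up. *)
Lemma upper_triangular_perm (s : 'S_n) A :
  reflect (forall x y, A x y != 0 -> (s x <= s y)%N)
    (upper_triangular (perm_mx s^-1%g *m A *m invmx (perm_mx s^-1%g))).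
Proof.
have -> : perm_mx s^-1%g *m A *m invmx (perm_mx s^-1%g)
    = \matrix_(i, j) A ((s^-1)%g i) ((s^-1)%g j).
  have -> : invmx (perm_mx s^-1%g) = perm_mx s :> 'M[R]_n.
    rewrite -[LHS]mul1mx -(perm_mx1 R n) -[1%g](mulgV s) perm_mxM.
    by rewrite -mulmxA mulmxV ?mulmx1 // unitmx_perm.
  rewrite -row_permE -{2}[s]invgK -col_permE.
  by apply/matrixP => i j; rewrite !mxE.
apply: (iffP (upper_triangularP _)) => [A0 x y|s_le i j ltji].
  apply: contraNleq => /A0; rewrite mxE !permK => ->; exact: eqxx.
rewrite mxE; apply: contraTeq ltji => /s_le.
by rewrite !permKV -leqNgt.
Qed.

Lemma triangularizable_rank A :
  (exists P : 'M[R]_n, is_perm_mx P /\ upper_triangular (P *m A *m invmx P)) ->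
  exists s : 'S_n, forall x y, 0 < A x y -> (s x <= s y)%N.
Proof.
move=> [_ [/is_perm_mxP[s ->]]]; rewrite -[s]invgK.
move=> /upper_triangular_perm s_le; exists (s^-1)%g => x y /lt0r_neq0.
exact: s_le.
Qed.

Lemma mulmx_entry_gt0 A B i k j : nonneg_mx A -> nonneg_mx B ->
  0 < A i k -> 0 < B k j -> 0 < (A *m B) i j.
Proof.
move=> A0 B0 Aik Bkj; rewrite mxE (bigD1 k) //= ltr_pwDl ?mulr_gt0 //.
by apply: sumr_ge0 => l _; rewrite mulr_ge0.
Qed.

Lemma mulmx_entry_gt0_witness A B i j : nonneg_mx A -> nonneg_mx B ->
  0 < (A *m B) i j -> exists k, 0 < A i k /\ 0 < B k j.
Proof.
move=> A0 B0; rewrite mxE => /lt0r_neq0.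
have AB0 k : true -> 0 <= A i k * B k j by rewrite mulr_ge0.
rewrite psumr_neq0 // => /hasP[k _ /= ABk]; exists k.
by move: (lt0r_neq0 ABk); rewrite mulf_eq0 negb_or !lt0r A0 B0 => /andP[-> ->].
Qed.

(** Triangularizability enters twice: that of [A] as an order [s] along which
    its positive entries go up, which makes [phi] inflationary, and that of
    [A *m B] as antisymmetry of its positive entries, which makes [phi]
    injective.  Equality of the diagonals makes [phi] stay in [L]. *)
Lemma crossing_entries_eq A B (s : 'S_n) i j :
  nonneg_mx A -> nonneg_mx B ->
  diag_part (A *m B) = diag_part (B *m A) ->
  (forall x y, 0 < A x y -> (s x <= s y)%N) ->
  (forall x y, 0 < (A *m B) x y -> 0 < (A *m B) y x -> x = y) ->
  0 < A i j -> 0 < B j i -> i = j.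
Proof.
move=> A0 B0 eqD s_le AB_anti Aij Bji.
have eqDk k : (A *m B) k k = (B *m A) k k.
  by have /matrixP/(_ k k) := eqD; rewrite !mxE eqxx !mulr1n.
pose L := [set k | 0 < (A *m B) k k].
(* Prescribing the value at [i] turns the fixed point there into [i = j]; the
   default [x] of the choice is never reached on [L]. *)
pose phi x :=
  if x == i then j else odflt x [pick k | (0 < A x k) && (0 < B k x)].
have phiP x : x \in L -> 0 < A x (phi x) /\ 0 < B (phi x) x.
  rewrite inE /phi => ABx; have [->|_] := eqVneq x i; first by [].
  case: pickP => [k /andP[]|none] //=.
  have [k [Axk Bkx]] := mulmx_entry_gt0_witness A0 B0 ABx.
  by have := none k; rewrite Axk Bkx.
have Li : i \in L by rewrite inE (mulmx_entry_gt0 _ _ Aij Bji).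
have phi_id : {in L, forall x, phi x = x}.
  apply: (@inflationary_perm_id _ _ _ (fun x => val (s x))).
  - by move=> x y /val_inj/perm_inj.
  - move=> x y /phiP[Ax Bx] /phiP[Ay By] exy; apply: AB_anti.
      by apply: (mulmx_entry_gt0 _ _ Ax); rewrite ?exy.
    by apply: (mulmx_entry_gt0 _ _ Ay); rewrite -?exy.
  - by move=> x /phiP[Ax Bx]; rewrite inE eqDk (mulmx_entry_gt0 _ _ Bx Ax).
  - by move=> x /phiP[Ax _]; apply: s_le.
by have := phi_id i Li; rewrite /phi eqxx.
Qed.

End NonnegativeMatrices.

Local Open Scope classical_set_scope.
Local Open Scope ring_scope.

Theorem corollary4p6 (R : realType) (n : nat) (S : set 'M[R]_n)
  (S_semigroup : mx_semigroup S)
  (S_nonneg : forall A : 'M[R]_n, S A -> nonneg_mx A)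
  (S_triang : forall A : 'M[R]_n, S A ->
    exists P : 'M[R]_n, is_perm_mx P /\ upper_triangular (P *m A *m invmx P))
  (S_diag : forall A B : 'M[R]_n, S A -> S B ->
    diag_part (A *m B) = diag_part (B *m A)) :
  exists P : 'M[R]_n, is_perm_mx P /\
    forall B : 'M[R]_n, [set P *m A *m invmx P | A in S] B ->
      upper_triangular B.
Proof.
pose r x y := `[< exists2 A, S A & 0 < A x y >].
have r_trans : transitive r.
  move=> y x z /asboolP[A SA Axy] /asboolP[B SB Byz]; apply/asboolP.
  exists (A *m B); first exact: S_semigroup.
  by apply: (mulmx_entry_gt0 _ _ Axy Byz); apply: S_nonneg.
have r_anti : antisymmetric r.
  move=> x y /andP[/asboolP[A SA Axy] /asboolP[B SB Byx]].
  have [s s_le] := triangularizable_rank (S_triang A SA).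
  have [t t_le] := triangularizable_rank (S_triang _ (S_semigroup A B SA SB)).
  apply: (crossing_entries_eq (S_nonneg A SA) (S_nonneg B SB) (S_diag A B SA SB)
            s_le _ Axy Byx) => u v /t_le le_uv /t_le le_vu.
  by apply/(@perm_inj _ t)/val_inj/anti_leq; rewrite le_uv.
have [s s_le] := linear_extension r_trans r_anti.
exists (perm_mx s^-1%g); split; first exact: perm_mx_is_perm.
move=> _ [A SA <-]; apply/upper_triangular_perm => x y Axy.
by apply/s_le/asboolP; exists A; rewrite // lt0r Axy S_nonneg.
Qed.
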